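(* For $L\in\mathbb{N}$, $\nu\in\mathbb{Z}_{> 0}$, $s = 0,1,\ldots,\nu-1$, and all integers $n\ge 2$, \[ G\left(L-2^{n-1}s-2^{n-2},\,L+2^{n-1}s+2^{n-2};\,\frac{(\frac{2^{2n}-1}{3}\nu+\frac{2^{2n-1}+1}{3})(\nu+s+1)}{2^{n-2}(2\nu+1)},\,\frac{(\frac{2^{2n}-1}{3}\nu+\frac{2^{2n-1}+1}{3})(\nu-s)}{2^{n-2}(2\nu+1)},\,2^{n-1}(2\nu+1)\right)\ge 0. \]
   Context: The $q$-binomial coefficient is $\begin{bmatrix}m\\ n\end{bmatrix}_q=\frac{(q;q)_m}{(q;q)_n(q;q)_{m-n}}$ for $m\ge n\ge 0$ and $0$ otherwise, where $(a;q)_L=\prod_{k=0}^{L-1}(1-aq^k)$. Define \[ G(N,M;\alpha,\beta,K)=\sum_{j\in\mathbb{Z}}(-1)^jq^{\frac{1}{2}Kj((\alpha+\beta)j+\alpha-\beta)}\begin{bmatrix}M+N\\ N-Kj\end{bmatrix}_{q}. \] ''$P(q)\ge 0$'' means the power series $P(q)$ has non-negative coefficients. *)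

(* Defs.v *)
From mathcomp Require Import all_boot all_order all_algebra.
Set Implicit Arguments. Unset Strict Implicit. Unset Printing Implicit Defensive.
Import Order.TTheory GRing.Theory Num.Theory.
Local Open Scope ring_scope.

Definition qpoch (L : nat) : {poly rat} := \prod_(k < L) (1 - 'X^(k.+1)).

(* q-binomial [m choose n]_q = (q;q)_m / ((q;q)_n (q;q)_{m-n}) for m >= n >= 0,
   and 0 otherwise (the division is exact polynomial division over rat). *)
Definition qbin (m n : nat) : {poly rat} :=
  if (n <= m)%N then qpoch m %/ (qpoch n * qpoch (m - n)) else 0.

Definition qbinZ (m n : int) : {poly rat} :=
  if (0 <= n) && (n <= m) then qbin `|m|%N `|n|%N else 0.

Definition Gexp (K : int) (alpha beta : rat) (j : int) : rat :=
  2^-1 * K%:~R * j%:~R * ((alpha + beta) * j%:~R + alpha - beta).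

Definition coef_at (p : {poly rat}) (d : rat) : rat :=
  if (denq d == 1) && (0 <= d) then p`_(`|numq d|%N) else 0.

(* Coefficient of q^e (e rational) in
   G(N,M;alpha,beta,K) = sum_{j in Z} (-1)^j q^{Gexp K alpha beta j} [M+N, N-Kj]_q.
   For K <> 0, every j with a nonzero summand satisfies |j| <= |N| + |M+N|,
   so the sum is taken over that (finite) range. *)
Definition Gcoef (N M : int) (alpha beta : rat) (K : int) (e : rat) : rat :=
  let B := (absz N + absz (M + N)%R)%N in
  \sum_(i < (B + B).+1)
     let j : int := (i%:Z - B%:Z) in
     (-1) ^+ `|j|%N * coef_at (qbinZ (M + N) (N - K * j)) (e - Gexp K alpha beta j).

Definition G_nonneg (N M : int) (alpha beta : rat) (K : int) : Prop :=
  forall e : rat, 0 <= Gcoef N M alpha beta K e.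

(* Main.v *)
Require Import Defs.
From mathcomp Require Import all_boot all_order all_algebra.
From mathcomp Require Import zify ring lra.
Import Order.TTheory GRing.Theory Num.Theory.
Local Open Scope ring_scope.
Set Implicit Arguments.
Unset Strict Implicit.
Unset Printing Implicit Defensive.

(** Put [K = 2 nu + 1] and [w_j = 2 K j + 2 s + 1].  Up to the factor [(-1)^j], the
    summand of the theorem is [q^(A_n j (K j + 2 s + 1)) [2L, L - 2^(n-2) w_j]_q] with
    [6 A_n = (4^n - 1) K + 3], and [w_j^2 = 4 K j (K j + 2 s + 1) + (2 s + 1)^2].
    The coefficients of the expansion
    [q^(v^2/2) [2L, L - v]_q = sum_k c_k [k, (k - v)/2]_q]
    are polynomials in [q^(1/2)] with nonnegative coefficients, namely
    [c_k = q^(k^2/2) sum_n q^(n(n+k)) [L, n]_q [L - n, k]_q].  Applied with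
    [v = 2^(n-1) w_j], it writes the sum for [n + 1], times a power of [q], as a
    nonnegative combination of sums for [n].  This descends to [n = 1], where
    splitting the sum according to the parity of [j] produces the
    Andrews-Baxter-Bressoud-Burge-Forrester-Viennot generating function for
    partitions with prescribed hook differences.  Each Pascal rule gives a
    recurrence for that function with nonnegative coefficients, and at every point
    of the parameter region one of the two recurrences stays inside the region or
    the function vanishes there.  Half-integral powers are avoided by working with
    [x] such that [x^2 = q]. *)

(** * Gaussian binomials *)

Fixpoint gauss (R : comNzRingType) (q : R) (m k : nat) : R :=
  match m, k with
  | _, 0 => 1
  | 0, _.+1 => 0
  | m'.+1, k'.+1 => gauss q m' k' + q ^+ k'.+1 * gauss q m' k'.+1
  end.

Section Gauss.
Variables (R : comNzRingType) (q : R).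
Local Notation gauss := (gauss q).

Lemma gauss0 m : gauss m 0 = 1. Proof. by case: m. Qed.

Lemma gaussS m k : gauss m.+1 k.+1 = gauss m k + q ^+ k.+1 * gauss m k.+1.
Proof. by []. Qed.

Lemma gauss_small m k : (m < k)%N -> gauss m k = 0.
Proof.
elim: m k => [|m IHm] [|k] // lt_mk.
by rewrite gaussS !IHm ?mulr0 ?addr0 // ltnW.
Qed.

Lemma gauss_diag m : gauss m m = 1.
Proof. by elim: m => // m IHm; rewrite gaussS IHm gauss_small // mulr0 addr0. Qed.

Lemma gaussS_alt m k :
  gauss m.+1 k.+1 = gauss m k.+1 + q ^+ (m - k) * gauss m k.
Proof.
elim: m k => [|m IHm] [|k].
- by rewrite gaussS /= expr0; ring.
- by rewrite !gauss_small // mulr0 addr0.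
- rewrite gaussS [in LHS]IHm [gauss m.+1 1]gaussS !gauss0 !subn0 !exprS; ring.
- rewrite gaussS [gauss m.+1 k.+2 in LHS]IHm [gauss m.+1 k.+1 in LHS]IHm.
  rewrite [gauss m.+1 k.+2]gaussS [gauss m.+1 k.+1]gaussS subSS.
  have [le_km|lt_mk] := ltnP k m; last by rewrite (@gauss_small m k.+1) //; ring.
  have -> : (m - k = (m - k.+1).+1)%N by lia.
  rewrite !exprS; ring.
Qed.

Lemma gauss_sym m k : (k <= m)%N -> gauss m (m - k) = gauss m k.
Proof.
elim: m k => [|m IHm] [|k] //; first by rewrite subn0 gauss_diag gauss0.
rewrite ltnS leq_eqVlt => /orP[/eqP->|lt_km].
  by rewrite subnn gauss0 gauss_diag.
have E : (m.+1 - k.+1 = (m - k.+1).+1)%N by lia.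
rewrite E gaussS_alt -E subSS (IHm k) ?(IHm k.+1) //; last exact: ltnW.
by rewrite gaussS subKn.
Qed.

(** Equating the two Pascal rules for [gauss m.+1 k.+1] gives this without any division, hence in
    every commutative ring. *)
Lemma gauss_ratio m k :
  (1 - q ^+ k.+1) * gauss m k.+1 = (1 - q ^+ (m - k)) * gauss m k.
Proof.
by have := gaussS m k; rewrite gaussS_alt => E; rewrite !mulrBl !mul1r;
  apply/eqP; rewrite subr_eq addrAC eq_sym subr_eq E; apply/eqP; ring.
Qed.

Lemma gauss_absorb m k :
  (1 - q ^+ k.+1) * gauss m.+1 k.+1 = (1 - q ^+ m.+1) * gauss m k.
Proof.
have [le_km|lt_mk] := leqP k m; last by rewrite !gauss_small ?mulr0.
rewrite gaussS mulrDr mulrCA gauss_ratio.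
have -> : (m.+1 = k.+1 + (m - k))%N by lia.
rewrite exprD; ring.
Qed.

Definition gaussZ (m : nat) (k : int) : R := if k is Posz k' then gauss m k' else 0.

Lemma gaussZ_out m k : (k < 0) || (m%:Z < k) -> gaussZ m k = 0.
Proof. by case: k => k //= lt_mk; apply: gauss_small; lia. Qed.

Lemma gaussZ_sym m k : gaussZ m (m%:Z - k) = gaussZ m k.
Proof.
have [out|] := boolP ((k < 0) || (m%:Z < k)).
  by rewrite !gaussZ_out //; lia.
case: k => k; last by lia.
move=> in_k; have le_km : (k <= m)%N by lia.
by rewrite subzn //= gauss_sym.
Qed.

Lemma gaussZS m k :
  gaussZ m.+1 k = gaussZ m (k - 1) + q ^+ `|k| * gaussZ m k.
Proof.
case: k => [[|k]|k].
- by rewrite (@gaussZ_out m (0 - 1)) // add0r mul1r /= !gauss0.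
- by have -> : k.+1%:Z - 1 = k by lia.
- by rewrite !gaussZ_out ?mulr0 ?addr0 //; lia.
Qed.

Lemma gaussZS_alt m k :
  gaussZ m.+1 k = gaussZ m k + q ^+ `|(m.+1%:Z - k)%R| * gaussZ m (k - 1).
Proof.
rewrite -gaussZ_sym gaussZS (_ : m.+1%:Z - k - 1 = m%:Z - k); last by lia.
rewrite gaussZ_sym (_ : m.+1%:Z - k = m%:Z - (k - 1)); last by lia.
rewrite gaussZ_sym; congr (_ + q ^+ _ * _); lia.
Qed.

(* The q-binomial [k choose (k - v)/2], or 0 when [k - v] is odd: the coefficient
   of [z^v] in the continuous q-Hermite polynomial [H_k] at [z + 1/z], so that
   [qherm_rec] is the three-term recurrence of these polynomials. *)
Definition qherm (k : nat) (v : int) : R :=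
  if (2 %| k%:Z - v)%Z then gaussZ k ((k%:Z - v) %/ 2)%Z else 0.

Lemma qherm_even (k : nat) (v i : int) : k%:Z - v = 2 * i -> qherm k v = gaussZ k i.
Proof.
by move=> E; rewrite /qherm E dvdz_mulr // mulKz.
Qed.

Lemma qherm_odd (k : nat) (v i : int) : k%:Z - v = 2 * i + 1 -> qherm k v = 0.
Proof. by move=> E; rewrite /qherm E; case: ifP => //; lia. Qed.

Lemma int_parity (v : int) : {i | v = 2 * i} + {i | v = 2 * i + 1}.
Proof.
have := divz_eq v 2; case: ((v %% 2)%Z =P 0) => E D.
  by left; exists (v %/ 2)%Z; lia.
by right; exists (v %/ 2)%Z; lia.
Qed.

Lemma qherm_out (k : nat) (v : int) : k%:Z < `|v| -> qherm k v = 0.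
Proof.
move=> lt_kv; case: (int_parity (k%:Z - v)) => [[i]|[i]] E.
  by rewrite (qherm_even E) gaussZ_out //; lia.
exact: qherm_odd E.
Qed.

Lemma qhermN (k : nat) (v : int) : qherm k (- v) = qherm k v.
Proof.
case: (int_parity (k%:Z - v)) => [[i]|[i]] E.
  rewrite (qherm_even E) -gaussZ_sym; apply: qherm_even; lia.
rewrite (qherm_odd E) (@qherm_odd _ _ (k%:Z - i - 1)) //; lia.
Qed.

Lemma gaussZ_absorb m k :
  (1 - q ^+ `|k|) * gaussZ m.+1 k = (1 - q ^+ m.+1) * gaussZ m (k - 1).
Proof.
case: k => [[|k]|k]; first by rewrite expr0 subrr mul0r gaussZ_out ?mulr0 //; lia.
  by have -> : k.+1%:Z - 1 = k :> int; [lia | exact: gauss_absorb].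
by rewrite !gaussZ_out ?mulr0 //; lia.
Qed.

(** When [k.+1 - v] is even, Pascal's rule on [qherm k.+1 v] reduces the claim to [gaussZ_absorb].
    At [k = 0] the factor [1 - q ^+ k] is zero, so the default value of [k.-1] is harmless. *)
Lemma qherm_rec (k : nat) (v : int) :
  qherm k (v - 1) + qherm k (v + 1) =
  qherm k.+1 v + (1 - q ^+ k) * qherm k.-1 v.
Proof.
case: (int_parity (k.+1%:Z - v)) => [[i]|[i]] E; last first.
  rewrite (@qherm_odd k (v - 1) i) ?(@qherm_odd k (v + 1) (i - 1)) //; try lia.
  rewrite (@qherm_odd k.+1 v i) //.
  case: k E => [|k] E; first by rewrite subrr mul0r.
  by rewrite (@qherm_odd k v (i - 1)) ?mulr0 //=; lia.
rewrite (@qherm_even k (v - 1) i) ?(@qherm_even k (v + 1) (i - 1)) //; try lia.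
rewrite (@qherm_even k.+1 v i) // gaussZS.
case: k E => [|k] E.
  rewrite subrr mul0r addr0 addrC; congr (_ + _).
  case: (i =P 0) => [->|/eqP i0]; first by rewrite mul1r.
  by rewrite gaussZ_out ?mulr0 //; lia.
rewrite (@qherm_even k v (i - 1)) -?gaussZ_absorb; [ring | rewrite /=; lia].
Qed.

Lemma qherm0 v : qherm 0 v = (v == 0)%:R.
Proof.
have [->|v0] := eqVneq v 0; first by rewrite (@qherm_even _ _ 0).
by rewrite qherm_out //; lia.
Qed.

Lemma qherm_double (m : nat) (v : int) :
  qherm m.*2 (2 * v) = gaussZ m.*2 (m%:Z - v).
Proof. by apply: qherm_even; lia. Qed.

End Gauss.

(** * Expansion of centered Gaussian binomials *)

Section Transform.
Variables (R : comNzRingType) (x : R).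
Local Notation q := (x ^+ 2).
Local Notation gauss := (gauss q).
Local Notation gaussZ := (gaussZ q).
Local Notation qherm := (qherm q).

Lemma qhermS (k : nat) (v : int) :
  qherm k.+1 v = qherm k (v + 1) + x ^+ `|(k.+1%:Z - v)%R| * qherm k (v - 1).
Proof.
case: (int_parity (k.+1%:Z - v)) => [[i]|[i]] E; last first.
  rewrite (@qherm_odd _ _ k (v - 1) i) ?(@qherm_odd _ _ k (v + 1) (i - 1)); try lia.
  by rewrite (@qherm_odd _ _ k.+1 v i) // mulr0 addr0.
rewrite (@qherm_even _ _ k (v - 1) i) ?(@qherm_even _ _ k (v + 1) (i - 1)); try lia.
rewrite (@qherm_even _ _ k.+1 v i) // gaussZS -exprM.
by congr (_ + x ^+ _ * _); lia.
Qed.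

(* Up to a power of [x], the sum over [n] of [q^(n(n+k))] times the q-trinomial
   coefficient of [L] with parts [n], [k], [L - n - k]. *)
Definition kernel_coef (L k : nat) : R :=
  x ^+ (k ^ 2) * \sum_(n < L.+1) q ^+ (n * (n + k)) * (gauss L n * gauss (L - n) k).

Lemma kernel_coef_small L k : (L < k)%N -> kernel_coef L k = 0.
Proof.
move=> lt_Lk; rewrite /kernel_coef big1 ?mulr0 // => n _.
by rewrite [gauss (L - n) k]gauss_small ?mulr0 //; lia.
Qed.

(** Pascal's rule for q-trinomial coefficients: [gaussS_alt] on the first factor, then on the
    second. *)
Lemma trinomialS L n k : (n <= L.+1)%N ->
  gauss L.+1 n * gauss (L.+1 - n) k =
  gauss L n * gauss (L - n) k
  + q ^+ (L.+1 - n - k) * (if k is k'.+1 then gauss L n * gauss (L - n) k' else 0)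
  + q ^+ (L.+1 - n) * (if n is n'.+1 then gauss L n' * gauss (L - n') k else 0).
Proof.
case: n => [_|n le_nL].
  rewrite !gauss0 mulr0 addr0 !mul1r !subn0; case: k => [|k].
    by rewrite !gauss0 mulr0 addr0.
  by rewrite gaussS_alt mul1r subSS.
rewrite gaussS_alt subSS mulrDl -mulrA; congr (_ + _).
have [->|ne_nL] := eqVneq n L.
  by rewrite (@gauss_small _ _ L L.+1) //; case: k => [|k]; ring.
have -> : (L - n = (L - n.+1).+1)%N by lia.
case: k => [|k]; first by rewrite !gauss0 mulr0 addr0.
by rewrite gaussS_alt subSS mulrDr mulrCA.
Qed.

Lemma kernel_coefS L k :
  kernel_coef L.+1 k =
  (1 + q ^+ L.*2.+1) * kernel_coef L k
  + x ^+ L.*2.+1 * ((if k is k'.+1 then kernel_coef L k' else 0)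
                    + (1 - q ^+ k.+1) * kernel_coef L k.+1).
Proof.
rewrite {1}/kernel_coef.
under eq_bigr => n _ do rewrite trinomialS -1?ltnS // !mulrDr.
rewrite !big_split /= !mulrDr.
set A := _ * \sum_(_ < _) _; set B := _ * \sum_(_ < _) _; set C := _ * \sum_(_ < _) _.
have -> : A = kernel_coef L k.
  by rewrite /A big_ord_recr /= (@gauss_small _ _ L L.+1) // mul0r mulr0 addr0.
have -> : B = x ^+ L.*2.+1 * (if k is k'.+1 then kernel_coef L k' else 0).
  rewrite /B; case: (k) => [|k'].
    by rewrite big1 ?mulr0 // => n _; rewrite !mulr0.
  rewrite big_ord_recr /= (@gauss_small _ _ L L.+1) // mul0r !mulr0 addr0.
  rewrite /kernel_coef !mulr_sumr; apply: eq_bigr => n _.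
  have [le_kLn|lt] := leqP k' (L - n); last first.
    by rewrite (@gauss_small _ _ (L - n)) // !mulr0.
  by rewrite !mulrA -!exprM -!exprD; congr (x ^+ _ * _ * _); have := ltn_ord n; nia.
have -> : C = q ^+ L.*2.+1 * kernel_coef L k
    + x ^+ L.*2.+1 * ((1 - q ^+ k.+1) * kernel_coef L k.+1);
  last by rewrite addrACA [in RHS]mulrDl mul1r.
rewrite /C /kernel_coef big_ord_recl /= !mulr0 add0r !mulr_sumr -big_split.
apply: eq_bigr => n _ /=; rewrite /bump /= !add1n.
have le_nL : (n <= L)%N by rewrite -ltnS.
(* This trades the factor [1 - q ^+ k.+1] for [1 - q ^+ (L - n - k)]. Its [1] yields the left side;
   the rest cancels the summand of [q ^+ L.*2.+1 * kernel_coef L k]. *)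
have E := gauss_ratio (x ^+ 2) (L - n) k.
have swap (a b c d e f : R) : a * (b * (c * (d * (e * f)))) = a * c * d * e * (b * f).
  by ring.
rewrite swap E.
have [le_kLn|lt] := leqP k (L - n); last first.
  by rewrite (@gauss_small _ _ (L - n)) // !(mulr0, addr0).
have [m EL] : exists m, (L = n + k + m)%N by exists (L - n - k)%N; lia.
have -> : (L.+1 - n.+1 = k + m)%N by lia.
have -> : (L - n - k = m)%N by lia.
have -> : (L.*2.+1 = n + n + k + k + m + m + 1)%N by lia.
move: (gauss _ k) (gauss L n) => g g'.
rewrite -!exprM.
rewrite mulrBl mul1r mulrBr addrCA -[LHS]addr0; congr (_ + _).
  by rewrite !mulrA -!exprD; congr (x ^+ _ * _ * _); lia.
apply/esym/eqP; rewrite subr_eq0 mulrACA !mulrA -!exprD; apply/eqP.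
by congr (x ^+ _ * _ * _); lia.
Qed.

(** Pascal's rule is used twice. The square weight makes the coefficients independent of [v], since
    [v^2 + 2(L + 1 - v) = 2L + 1 + (v - 1)^2], and likewise with [-v]. *)
Lemma centered_gaussZ_rec (L : nat) (v : int) :
  x ^+ (`|v| ^ 2) * gaussZ L.+1.*2 (L.+1%:Z - v) =
  (1 + q ^+ L.*2.+1) * (x ^+ (`|v| ^ 2) * gaussZ L.*2 (L%:Z - v))
  + x ^+ L.*2.+1 * (x ^+ (`|(v - 1)%R| ^ 2) * gaussZ L.*2 (L%:Z - (v - 1))
                  + x ^+ (`|(v + 1)%R| ^ 2) * gaussZ L.*2 (L%:Z - (v + 1))).
Proof.
rewrite doubleS gaussZS (_ : L.+1%:Z - v - 1 = L%:Z - v); last by lia.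
rewrite !(gaussZS_alt _ L.*2).
rewrite (_ : L.+1%:Z - v - 1 = L%:Z - v); last by lia.
have out (k : int) : (L.*2%:Z < k) || (k < 0) -> gaussZ L.*2 k = 0.
  by move=> out_k; rewrite gaussZ_out // orbC.
have E1 : x ^+ (`|v| ^ 2) * (q ^+ `|(L.*2.+1%:Z - (L%:Z - v))%R|
      * gaussZ L.*2 (L%:Z - v - 1))
    = x ^+ L.*2.+1 * (x ^+ (`|(v + 1)%R| ^ 2) * gaussZ L.*2 (L%:Z - (v + 1))).
  rewrite (_ : L%:Z - v - 1 = L%:Z - (v + 1)); last by lia.
  have [lt|le] := ltP (L.*2%:Z) (L%:Z - (v + 1)); first by rewrite out ?lt // !mulr0.
  by rewrite !mulrA -exprM -!exprD; congr (x ^+ _ * _); nia.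
have E2 : x ^+ (`|v| ^ 2) * (q ^+ `|(L.+1%:Z - v)%R| * gaussZ L.*2 (L.+1%:Z - v))
    = x ^+ L.*2.+1 * (x ^+ (`|(v - 1)%R| ^ 2) * gaussZ L.*2 (L%:Z - (v - 1))).
  rewrite (_ : L.+1%:Z - v = L%:Z - (v - 1)); last by lia.
  have [lt|le] := ltP (L%:Z - (v - 1)) 0; first by rewrite out ?lt ?orbT // !mulr0.
  by rewrite !mulrA -exprM -!exprD; congr (x ^+ _ * _); nia.
have E3 : q ^+ `|(L.+1%:Z - v)%R| * (q ^+ `|(L.*2.+1%:Z - (L.+1%:Z - v))%R|
      * gaussZ L.*2 (L%:Z - v)) = q ^+ L.*2.+1 * gaussZ L.*2 (L%:Z - v).
  have [o|] := boolP ((L.*2%:Z < L%:Z - v) || (L%:Z - v < 0)).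
    by rewrite out // !mulr0.
  by move=> le; rewrite mulrA -exprD; congr (_ ^+ _ * _); lia.
by rewrite !mulrDr E1 E2 E3 mulrDl; ring.
Qed.

(** Induction on [L] by [centered_gaussZ_rec]: [qherm_rec] turns the sum over the neighbours [v - 1]
    and [v + 1] into shifts of [k], and [kernel_coefS] is the transposed recurrence for the
    coefficients. *)
Lemma qherm_double_expand (L : nat) (v : int) :
  x ^+ (`|v| ^ 2) * qherm L.*2 (2 * v) =
  \sum_(k < L.+1) kernel_coef L k * qherm k v.
Proof.
rewrite qherm_double; elim: L v => [|L IHL] v.
  rewrite big_ord1 qherm0 /kernel_coef big_ord1 !gauss0 !expr0 !mul1r.
  have [->|v0] := eqVneq v 0; first by rewrite mul1r.
  by rewrite mulr0n gaussZ_out ?mulr0 //; lia.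
rewrite centered_gaussZ_rec !IHL -big_split /=.
under [X in _ + _ * X]eq_bigr => k _ do rewrite -mulrDr qherm_rec mulrDr.
rewrite big_split /=.
have D k : kernel_coef L.+1 k * qherm k v =
    (1 + q ^+ L.*2.+1) * (kernel_coef L k * qherm k v)
    + x ^+ L.*2.+1 * ((if k is k'.+1 then kernel_coef L k' else 0) * qherm k v
                      + (1 - q ^+ k.+1) * kernel_coef L k.+1 * qherm k v).
  by rewrite kernel_coefS; case: k => [|k]; ring.
under [RHS]eq_bigr => k _ do rewrite D.
rewrite big_split /= -!mulr_sumr big_split /=; congr (_ * _ + _ * (_ + _)).
- by rewrite [RHS]big_ord_recr /= kernel_coef_small // mul0r addr0.
- by rewrite [RHS]big_ord_recl /= mul0r add0r.
rewrite [LHS]big_ord_recl [RHS]big_ord_recr [X in _ = X + _]big_ord_recr /=.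
rewrite !(@kernel_coef_small L _.+1) // !(mulr0, mul0r, addr0).
rewrite expr0 subrr mul0r mulr0 add0r.
by apply: eq_bigr => k _; rewrite /bump /= add1n; ring.
Qed.
End Transform.

(** * Sums over symmetric integer ranges *)

Section IntegerSum.
Variable V : comNzRingType.
Implicit Types (f g : int -> V) (N M : nat).

Definition zsum N f : V := \sum_(i < (N + N).+1) f (i%:Z - N%:Z).

Lemma zsum0 f : zsum 0 f = f 0.
Proof. by rewrite /zsum big_ord1. Qed.

Lemma zsumS N f : zsum N.+1 f = zsum N f + (f N.+1%:Z + f (- N.+1%:Z)).
Proof.
rewrite /zsum addSn addnS big_ord_recr big_ord_recl /=.
rewrite [f _ + \sum_(_ < _) _]addrC -addrA [X in _ + X = _]addrC.
congr (_ + (f _ + f _)); try lia.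
by apply: eq_bigr => i _; congr f; rewrite /bump /=; lia.
Qed.

Lemma eq_zsum N f g : f =1 g -> zsum N f = zsum N g.
Proof. by move=> E; apply: eq_bigr => i _; rewrite E. Qed.

Lemma zsumD N f g : zsum N f + zsum N g = zsum N (fun j => f j + g j).
Proof. by rewrite /zsum big_split. Qed.

Lemma zsumB N f g : zsum N (fun j => f j - g j) = zsum N f - zsum N g.
Proof. by rewrite /zsum sumrB. Qed.

Lemma zsum_opp N f : zsum N (fun j => f (- j)) = zsum N f.
Proof.
elim: N => [|N IHN]; first by rewrite !zsum0 oppr0.
by rewrite !zsumS IHN opprK [f (- _) + _]addrC.
Qed.

Lemma zsum_shift N f :
  zsum N (fun j => f (j + 1)) + f (- N%:Z) = zsum N f + f (N%:Z + 1).
Proof.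
elim: N => [|N IHN]; first by rewrite !zsum0 oppr0 add0r addrC.
rewrite !zsumS (_ : - N.+1%:Z + 1 = - N%:Z); last by lia.
rewrite (_ : N.+1%:Z = N%:Z + 1); last by lia.
rewrite [f _ + f (- N%:Z)]addrC addrA IHN -!addrA; congr (_ + (_ + _)).
exact: addrC.
Qed.

(** The odd indices [-(2j + 1)] with [|j| <= N] run from [-(2N + 1)] to [2N - 1], which leaves
    [2N + 1] over. *)
Lemma zsum_parity N f :
  zsum N.*2.+1 f =
  zsum N (fun j => f (2 * j)) + zsum N (fun j => f (- (2 * j + 1)))
  + f N.*2.+1%:Z.
Proof.
elim: N => [|N IHN]; first by rewrite zsumS !zsum0 addrA addrAC.
rewrite doubleS zsumS zsumS IHN !zsumS.
rewrite (_ : 2 * N.+1%:Z = N.*2.+2%:Z); last by lia.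
rewrite (_ : 2 * - N.+1%:Z = - N.*2.+2%:Z); last by lia.
rewrite (_ : - (N.*2.+2%:Z + 1) = - N.*2.+3%:Z); last by lia.
rewrite (_ : - (- N.*2.+2%:Z + 1) = N.*2.+1%:Z); last by lia.
by ring.
Qed.

Lemma zsum_stable N M f : (M <= N)%N ->
  (forall j : int, M%:Z < `|j| -> f j = 0) -> zsum N f = zsum M f.
Proof.
move=> le_MN f0; rewrite -(subnK le_MN); elim: (N - M)%N => // d IHd.
by rewrite addSn zsumS IHd !f0 ?addr0 //; lia.
Qed.

End IntegerSum.

Lemma zsumMl (R : comNzRingType) (c : R) N f :
  c * zsum N f = zsum N (fun j => c * f j).
Proof. by rewrite /zsum mulr_sumr. Qed.

(** * Polynomials with nonnegative coefficients *)

Definition nonneg (p : {poly rat}) := forall i, 0 <= p`_i.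

Lemma nonneg0 : nonneg 0.
Proof. by move=> i; rewrite coef0. Qed.

Lemma nonnegXn n : nonneg 'X^n.
Proof. by move=> i; rewrite coefXn ler0n. Qed.

Lemma nonnegD p r : nonneg p -> nonneg r -> nonneg (p + r).
Proof. by move=> Hp Hr i; rewrite coefD addr_ge0. Qed.

Lemma nonnegM p r : nonneg p -> nonneg r -> nonneg (p * r).
Proof. by move=> Hp Hr i; rewrite coefM sumr_ge0 // => j _; rewrite mulr_ge0. Qed.

Lemma nonneg_sum n (F : 'I_n -> {poly rat}) :
  (forall i, nonneg (F i)) -> nonneg (\sum_i F i).
Proof. by move=> HF; apply: big_ind => //; [exact: nonneg0 | exact: nonnegD]. Qed.

Lemma nonneg_cancelXn n (p : {poly rat}) : nonneg ('X^n * p) -> nonneg p.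
Proof.
move=> nn i; by have := nn (i + n)%N; rewrite coefXnM ltnNge leq_addl /= addnK.
Qed.

Local Notation qH := (qherm ('X^2 : {poly rat})).

Lemma nonneg_gauss (m k : nat) : nonneg (gauss ('X^2 : {poly rat}) m k).
Proof.
elim: m k => [|m IHm] [|k]; rewrite ?gauss0; try exact: (nonnegXn 0).
  exact: nonneg0.
by rewrite gaussS -exprM; apply: nonnegD => //; apply: nonnegM => //; apply: nonnegXn.
Qed.

(** * Partitions with prescribed hook differences *)

Section HookDifferences.
Variables p p' a : int.
Hypotheses (p_gt0 : 0 < p) (lt_pp' : p < p') (a_gt0 : 0 < a) (lt_ap' : a < p').

Let e1 (r j : int) := j * (p * p' * j + p' * r - p * a).
Let e2 (r j : int) := (p * j + r) * (p' * j + a).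

(* The alternating-sum form of the generating function of partitions with
   prescribed hook differences, with [q = 'X^2]. *)
Definition hook_sum (N L : nat) (r b : int) : {poly rat} :=
  zsum N (fun j => 'X^(`|2 * e1 r j|) * qH L (b - a + 2 * p' * j)
                 - 'X^(`|2 * e2 r j|) * qH L (b + a + 2 * p' * j)).

(** With [hook_exp2_ge0], this shows that the absolute values in the exponents of [hook_sum] change
    nothing for [0 <= r <= p], so the recurrences reduce to integer identities between exponents. *)
Lemma hook_exp1_ge0 r j : 0 <= r <= p -> 0 <= e1 r j.
Proof.
move=> /andP[r0 rp]; rewrite /e1.
have [->|[j1|j1]] : j = 0 \/ (1 <= j \/ j <= -1) by lia.
- by rewrite mul0r.
- apply: mulr_ge0; first by lia.
  have : 0 <= p * (p' * j - a) by apply: mulr_ge0; nia.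
  have : 0 <= p' * r by apply: mulr_ge0; lia.
  lia.
- apply: mulr_le0; first by lia.
  have : 0 <= p * (- p' * j - p') by apply: mulr_ge0; nia.
  have : 0 <= p' * (p - r) by apply: mulr_ge0; lia.
  have : 0 <= p * a by apply: mulr_ge0; lia.
  lia.
Qed.

Lemma hook_exp2_ge0 r j : 0 <= r <= p -> 0 <= e2 r j.
Proof.
move=> /andP[r0 rp]; rewrite /e2.
have [j0|j1] : 0 <= j \/ j <= -1 by lia.
  by apply: mulr_ge0; nia.
by apply: mulr_le0; nia.
Qed.

Lemma qherm_step_down (c d e e' L : nat) (v : int) :
  (v - 1 <= L%:Z -> c%:Z + e%:Z + (L%:Z + 1 - v) = d%:Z + e'%:Z) ->
  'X^c * ('X^e * qH L.+1 v) =
  'X^c * ('X^e * qH L (v + 1)) + 'X^d * ('X^e' * qH L (v - 1)).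
Proof.
move=> E; rewrite qhermS !mulrDr; congr (_ + _).
have [le|lt] := leP (v - 1) L%:Z; last first.
  by rewrite (@qherm_out _ _ _ (v - 1)) ?mulr0 //; lia.
by rewrite !mulrA -!exprD; congr ('X^ _ * _); have := E le; lia.
Qed.

Lemma qherm_step_up (c d e e' L : nat) (v : int) :
  (- L%:Z <= v + 1 -> c%:Z + e%:Z + (L%:Z + 1 + v) = d%:Z + e'%:Z) ->
  'X^c * ('X^e * qH L.+1 v) =
  'X^c * ('X^e * qH L (v - 1)) + 'X^d * ('X^e' * qH L (v + 1)).
Proof.
move=> E; rewrite -(qhermN _ _ v) -(qhermN _ _ (v - 1)) -(qhermN _ _ (v + 1)).
rewrite !opprD opprK; apply: qherm_step_down => le; rewrite -E; lia.
Qed.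

Lemma hook_sum_down N L r b : 0 <= r - 1 -> r <= p -> 0 <= b ->
  'X^(`|b|) * hook_sum N L.+1 r b =
  'X^(`|b|) * hook_sum N L r (b + 1)
  + 'X^(`|(L.+1%:Z + a)%R|) * hook_sum N L (r - 1) (b - 1).
Proof.
move=> r1 rp b0; rewrite /hook_sum !zsumMl zsumD; apply: eq_zsum => j /=.
rewrite !mulrBr [in RHS]addrACA -opprD.
have P : 0 <= r <= p by lia.
have P' : 0 <= r - 1 <= p by lia.
have := (hook_exp1_ge0 j P, hook_exp1_ge0 j P', hook_exp2_ge0 j P, hook_exp2_ge0 j P').
rewrite /e1 /e2 => -[[[? ?] ?] ?].
congr (_ - _).
  rewrite (_ : b + 1 - a + 2 * p' * j = b - a + 2 * p' * j + 1); last by ring.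
  rewrite (_ : b - 1 - a + 2 * p' * j = b - a + 2 * p' * j - 1); last by ring.
  by apply: qherm_step_down => _; rewrite !gez0_abs //; lia.
rewrite (_ : b + 1 + a + 2 * p' * j = b + a + 2 * p' * j + 1); last by ring.
rewrite (_ : b - 1 + a + 2 * p' * j = b + a + 2 * p' * j - 1); last by ring.
by apply: qherm_step_down => _; rewrite !gez0_abs //; lia.
Qed.

Lemma hook_sum_up N L r b : 0 <= r -> r + 1 <= p -> 0 <= b ->
  'X^(`|a|) * hook_sum N L.+1 r b =
  'X^(`|a|) * hook_sum N L r (b - 1)
  + 'X^(`|(L.+1%:Z + b)%R|) * hook_sum N L (r + 1) (b + 1).
Proof.
move=> r1 rp b0; rewrite /hook_sum !zsumMl zsumD; apply: eq_zsum => j /=.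
rewrite !mulrBr [in RHS]addrACA -opprD.
have P : 0 <= r <= p by lia.
have P' : 0 <= r + 1 <= p by lia.
have := (hook_exp1_ge0 j P, hook_exp1_ge0 j P', hook_exp2_ge0 j P, hook_exp2_ge0 j P').
rewrite /e1 /e2 => -[[[? ?] ?] ?].
congr (_ - _).
  rewrite (_ : b + 1 - a + 2 * p' * j = b - a + 2 * p' * j + 1); last by ring.
  rewrite (_ : b - 1 - a + 2 * p' * j = b - a + 2 * p' * j - 1); last by ring.
  by apply: qherm_step_up => _; rewrite !gez0_abs //; lia.
rewrite (_ : b + 1 + a + 2 * p' * j = b + a + 2 * p' * j + 1); last by ring.
rewrite (_ : b - 1 + a + 2 * p' * j = b + a + 2 * p' * j - 1); last by ring.
by apply: qherm_step_up => _; rewrite !gez0_abs //; lia.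
Qed.

(* The sum vanishes on the two corners [(r, b) = (0, 0)] and [(p, p')] of the region
   of [hook_sum_nonneg], where neither recurrence stays inside the region. *)
Lemma hook_sum_bottom N L : hook_sum N L 0 0 = 0.
Proof.
rewrite /hook_sum zsumB; apply/eqP; rewrite subr_eq0 -zsum_opp; apply/eqP.
apply: eq_zsum => j; rewrite -qhermN.
by congr ('X^(`|_|) * qH _ _); rewrite /e1 /e2; ring.
Qed.

Lemma hook_sum_top N L : (L <= N)%N -> hook_sum N L p p' = 0.
Proof.
move=> le_LN; rewrite /hook_sum zsumB; apply/eqP; rewrite subr_eq0 -zsum_opp.
set f := (fun j => 'X^(`|2 * e2 p j|) * _).
have -> : zsum N (fun j => 'X^(`|2 * e1 p (- j)|) * qH L (p' - a + 2 * p' * - j))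
        = zsum N (fun j => f (j - 1)).
  apply: eq_zsum => j; rewrite /f -[qH _ (_ + a + _)]qhermN.
  by congr ('X^(`|_|) * qH _ _); rewrite /e1 /e2; ring.
have := zsum_shift N (fun j => f (j - 1)).
rewrite (@eq_zsum _ _ (fun j => f (j + 1 - 1)) f) => [|j]; last by congr f; ring.
(* The two boundary terms of the shift vanish because [L <= N]. *)
rewrite addrK /f !(@qherm_out _ _ L) ?mulr0 ?addr0 => [->//||].
  have : 0 <= p' * N by apply: mulr_ge0; lia.
  nia.
nia.
Qed.

(** In the coordinates [r] and [b - r] the region is a rectangle. The summands of [hook_sum_down]
    lower [r] or raise [b - r]; those of [hook_sum_up] raise [r] or lower [b - r]. The former leave
    the region only from [r = 0] or [b - r = p' - p]; there the latter stay inside, except at the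
    two vanishing corners. *)
Lemma hook_sum_nonneg N L r b :
  (L <= N)%N -> 0 <= r <= p -> r <= b <= p' - p + r -> nonneg (hook_sum N L r b).
Proof.
elim: L r b => [|L IHL] r b le_LN /andP[r0 rp] /andP[rb bp].
  apply: nonneg_sum => i; move: (i%:Z - N%:Z) => j.
  (* At [L = 0] the subtracted family is zero: [0 < a + b < 2p'], so [2p'] does not divide
     [a + b]. *)
  rewrite !qherm0 [b + a + _ == 0](_ : _ = false) ?mulr0 ?subr0.
    apply: nonnegM; first exact: nonnegXn.
    by case: eqP => _; [exact: (nonnegXn 0) | exact: nonneg0].
  have j_cases : 0 <= j \/ j <= -1 by lia.
  by apply/eqP; case: j_cases; nia.
have [r_eq0|r_neq0] := eqVneq r 0.
  have [b_eq0|b_neq0] := eqVneq b 0.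
    by rewrite r_eq0 b_eq0 hook_sum_bottom; apply: nonneg0.
  apply: (@nonneg_cancelXn `|a|); rewrite hook_sum_up; try lia.
  by apply: nonnegD; apply: nonnegM; try exact: nonnegXn; apply: IHL; lia.
have [b_top|b_ntop] := eqVneq b (p' - p + r); last first.
  apply: (@nonneg_cancelXn `|b|); rewrite hook_sum_down; try lia.
  by apply: nonnegD; apply: nonnegM; try exact: nonnegXn; apply: IHL; lia.
have [r_top|r_ntop] := eqVneq r p.
  by rewrite (_ : b = p') ?r_top ?hook_sum_top //; [exact: nonneg0 | lia].
apply: (@nonneg_cancelXn `|a|); rewrite hook_sum_up; try lia.
by apply: nonnegD; apply: nonnegM; try exact: nonnegXn; apply: IHL; lia.
Qed.

End HookDifferences.

(** * The iteration in n *)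

Lemma nonneg_kernel_coef L k : nonneg (kernel_coef ('X : {poly rat}) L k).
Proof.
apply: nonnegM; first exact: nonnegXn.
apply: nonneg_sum => n; rewrite -exprM.
by apply: nonnegM; [exact: nonnegXn | apply: nonnegM; exact: nonneg_gauss].
Qed.

Lemma absz_double (A : nat) (y z : int) :
  y = 2 * A%:Z * z -> (2 * (A * `|z|))%N = `|y|%N.
Proof. by move=> ->; rewrite !abszM mulnA. Qed.

(** This is [A_n] for [n = m + 1]; the increment is that of [bressoud_sum_step] at [c = 2 ^ m]. *)
Fixpoint bressoud_slope (nu m : nat) : nat :=
  if m is m'.+1 then (bressoud_slope nu m' + 2 * (2 ^ m') ^ 2 * (2 * nu + 1))%N
  else nu.+1.

Lemma bressoud_slopeE nu m :
  (6 * bressoud_slope nu m + (2 * nu + 1) = 4 ^ m.+1 * (2 * nu + 1) + 3)%N.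
Proof.
elim: m => [|m IHm]; first by rewrite /=; lia.
have sqr2m : ((2 ^ m) ^ 2 = 4 ^ m)%N by rewrite -expnM mulnC expnM.
rewrite /= sqr2m.
by rewrite expnS; move: IHm; rewrite expnS; lia.
Qed.

Lemma bressoud_slope_rat nu m :
  ((2 ^ (2 * m.+1) - 1)%N%:R / 3%:R) * nu%:R + ((2 ^ (2 * m.+1 - 1) + 1)%N%:R / 3%:R)
  = (bressoud_slope nu m)%:R :> rat.
Proof.
have pow : (4 ^ m.+1 = 2 * 2 ^ (2 * m.+1 - 1))%N.
  by rewrite -expnS -(expnM 2 2); congr (2 ^ _)%N; lia.
have := bressoud_slopeE nu m; rewrite expnM pow natrB; last first.
  by rewrite muln_gt0 expn_gt0.
move: (bressoud_slope nu m) (2 ^ _)%N => b u E.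
suff : 6 * b%:R + (2 * nu%:R + 1) = 2 * u%:R * (2 * nu%:R + 1) + 3 :> rat by lra.
transitivity ((6 * b + (2 * nu + 1))%N%:R : rat); first by ring.
by rewrite E; ring.
Qed.

(** Here [alpha + beta = b / d] and [alpha - beta = b (2s + 1) / (d (2nu + 1))]; half the modulus,
    [d (2nu + 1)], clears both denominators. *)
Lemma Gexp_bressoud (b d nu s : nat) (j : int) : (0 < d)%N -> (s <= nu)%N ->
  Gexp (2 * d * (2 * nu + 1))%N%:Z
    (b%:R * (nu + s + 1)%N%:R / (d%:R * (2 * nu + 1)%N%:R))
    (b%:R * (nu - s)%N%:R / (d%:R * (2 * nu + 1)%N%:R)) j
  = b%:R * (j * ((2 * nu%:Z + 1) * j + 2 * s%:Z + 1))%:~R.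
Proof.
move=> d_gt0 le_s_nu; rewrite /Gexp natrB //.
have d0 : d%:R != 0 :> rat by rewrite pnatr_eq0 -lt0n.
have k0 : 2 * nu%:R + 1 != 0 :> rat by rewrite -natrM natr1 pnatr_eq0.
by field; rewrite k0 d0.
Qed.

Section BressoudSums.
Variables nu s : nat.
Hypothesis lt_s_nu : (s < nu)%N.

Local Notation K := (2 * nu%:Z + 1).
Local Notation w j := (2 * K * j + 2 * s%:Z + 1).
Local Notation g j := (j * (K * j + 2 * s%:Z + 1)).

(* For [c = 2^(n-1)], [A = bressoud_slope nu (n-1)] and [k = 2L] this is the sum of
   the theorem with [q = 'X^2]. *)
Definition bressoud_sum (N A c k : nat) : {poly rat} :=
  zsum N (fun j => (-1) ^+ `|j| * ('X^(2 * (A * `|g j|)) * qH k (c%:Z * w j))).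

Lemma bressoud_exp_ge0 (j : int) : 0 <= g j.
Proof.
have [->|[j1|j1]] : j = 0 \/ (1 <= j \/ j <= -1) by lia.
- by rewrite mul0r.
- by apply: mulr_ge0; nia.
- by apply: mulr_le0; nia.
Qed.

Lemma bressoud_sum_base N k : (k <= N)%N -> nonneg (bressoud_sum N nu.+1 1 k).
Proof.
move=> le_kN; rewrite /bressoud_sum; set f := (fun j => _).
have f0 (j : int) : k%:Z < `|j| -> f j = 0.
  move=> lt_kj; rewrite /f qherm_out ?mulr0 // mul1r.
  have [?|?] : 1 <= j \/ j <= -1 by lia.
    nia.
  nia.
rewrite (zsum_stable le_kN f0) -(@zsum_stable _ k.*2.+1 k f) //; last by lia.
rewrite zsum_parity f0 ?addr0; last by lia.
(* Matching [w_(2j) = 4Kj + 2s + 1] and [-w_(-2j-1) = 4Kj + 2K - 2s - 1] with [b - a + 2p'j] and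
   [b + a + 2p'j] forces [p' = 2K], [b = K], [a = 2nu - 2s]; the exponents [(nu + 1) g] then give
   [p = 2nu + 2] and [r = nu + 1]. *)
suff -> : zsum k (fun j => f (2 * j)) + zsum k (fun j => f (- (2 * j + 1)))
        = hook_sum (2 * nu%:Z + 2) (4 * nu%:Z + 2) (2 * nu%:Z - 2 * s%:Z) k k
            (nu%:Z + 1) K.
  by apply: hook_sum_nonneg; lia.
rewrite zsumD; apply: eq_zsum => j; rewrite /f.
rewrite -signr_odd (_ : odd `|(2 * j)%R| = false) ?expr0; last by lia.
rewrite -signr_odd (_ : odd `|(- (2 * j + 1))%R| = true) ?expr1; last by lia.
rewrite mulN1r !mul1r -[qH k (_ * - _ + _ + _)]qhermN.
congr ('X^_ * qH _ _ - 'X^_ * qH _ _); last 1 first.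
- by ring.
- by apply: absz_double; lia.
- by ring.
- by apply: absz_double; lia.
Qed.

Lemma bressoud_sum_step N A c :
  (forall k, (k <= N)%N -> nonneg (bressoud_sum N A c k)) ->
  forall k, (k <= N)%N ->
    nonneg (bressoud_sum N (A + 2 * c ^ 2 * (2 * nu + 1)) (2 * c) k).
Proof.
move=> IH k le_kN.
(* For odd [k] every summand vanishes, as [2 * c * w_j] is even. *)
have [k_odd|k_even] := boolP (odd k).
  rewrite /bressoud_sum /zsum big1 => [|i _]; first exact: nonneg0.
  move: (_%:Z - _%:Z) => j.
  rewrite (@qherm_odd _ _ _ _ (k./2%:Z - c%:Z * w j)) ?mulr0 //.
  by have := odd_double_half k; rewrite k_odd; lia.
have [L Ek] : exists L, k = L.*2 by exists k./2; rewrite even_halfK.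
(* At [v = c w_j] the weight in [qherm_double_expand] has exponent [4 c^2 K g_j + c^2 (2s + 1)^2].
   The first part is twice the increment of [A] times [g_j], the second is this common factor. *)
apply: (@nonneg_cancelXn (c ^ 2 * (2 * s + 1) ^ 2)).
suff -> : 'X^(c ^ 2 * (2 * s + 1) ^ 2)
      * bressoud_sum N (A + 2 * c ^ 2 * (2 * nu + 1)) (2 * c) k
    = \sum_(i < L.+1) kernel_coef 'X L i * bressoud_sum N A c i.
  apply: nonneg_sum => i; apply: nonnegM; first exact: nonneg_kernel_coef.
  by apply: IH; have := ltn_ord i; lia.
under [RHS]eq_bigr => i _ do rewrite /bressoud_sum zsumMl.
rewrite zsumMl /zsum exchange_big; apply: eq_bigr => i _ /=.
move: (_%:Z - _%:Z) => j.
under eq_bigr => l _ do rewrite mulrCA [X in _ * X]mulrCA mulrA.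
rewrite -mulr_sumr -qherm_double_expand Ek.
rewrite mulrCA -!mulrA; congr (_ * _); rewrite !mulrA -!exprD.
congr ('X^ _ * qH _ _).
suff W : (`|w j| ^ 2 = 4 * (2 * nu + 1) * `|g j| + (2 * s + 1) ^ 2)%N.
  by rewrite (abszM c%:Z (w j)) expnMn W; lia.
have G := gez0_abs (bressoud_exp_ge0 j).
have W : (`|w j| ^ 2)%N%:Z = w j ^+ 2 by rewrite -abszX gez0_abs ?sqr_ge0.
by apply/eqP; rewrite -eqz_nat W PoszD PoszM G !PoszM !PoszD; apply/eqP; ring.
Qed.

Lemma bressoud_sum_nonneg N m k :
  (k <= N)%N -> nonneg (bressoud_sum N (bressoud_slope nu m) (2 ^ m) k).
Proof.
elim: m k => [|m IHm] k; first exact: bressoud_sum_base.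
by rewrite expnS; apply: bressoud_sum_step.
Qed.

End BressoudSums.

(** * Comparison with the definition of G *)

Lemma gauss_morph (R S : comNzRingType) (f : {rmorphism R -> S}) (q : R) m k :
  gauss (f q) m k = f (gauss q m k).
Proof.
elim: m k => [|m IHm] [|k]; rewrite ?gauss0 ?rmorph1 ?rmorph0 //.
by rewrite !gaussS rmorphD rmorphM rmorphXn !IHm.
Qed.

Lemma gaussZ_morph (R S : comNzRingType) (f : {rmorphism R -> S}) (q : R) m k :
  gaussZ (f q) m k = f (gaussZ q m k).
Proof. by case: k => k; rewrite /= ?gauss_morph ?rmorph0. Qed.

Lemma qpoch_gauss m k : (k <= m)%N ->
  gauss 'X m k * (qpoch k * qpoch (m - k)) = qpoch m.
Proof.
elim: k => [|k IHk] lt_km.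
  by rewrite gauss0 subn0 /qpoch big_ord0 !mul1r.
rewrite -IHk ?(ltnW lt_km) // (_ : (m - k = (m - k.+1).+1)%N); last by lia.
rewrite /qpoch ![\prod_(_ < _.+1) _]big_ord_recr /=.
have := gauss_ratio ('X : {poly rat}) m k.
rewrite (_ : (m - k = (m - k.+1).+1)%N); last by lia.
set P := \prod_(_ < _) _; set Q := \prod_(_ < _) _ => E.
transitivity ((1 - 'X^(k.+1)) * gauss 'X m k.+1 * (P * Q)); first by ring.
by rewrite E; ring.
Qed.

Lemma qpoch_neq0 m : qpoch m != 0.
Proof.
apply/prodf_neq0 => i _; apply/eqP => /polyP /(_ 0%N).
by rewrite coefB coef1 coefXn coef0.
Qed.

Lemma qbinZ_gaussZ (m : nat) (k : int) : qbinZ m k = gaussZ 'X m k.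
Proof.
rewrite /qbinZ; case: k => [k|k] //=.
rewrite lez_nat /qbin; case: leqP => [le_km|lt_mk]; last by rewrite gauss_small.
by rewrite -(qpoch_gauss le_km) mulpK // mulf_neq0 ?qpoch_neq0.
Qed.

(** Both sides are zero when [e] is not a natural number or is below [d]. *)
Lemma coef_atB p e (d : nat) : coef_at p (e - d%:R) = coef_at ('X^d * p) e.
Proof.
rewrite /coef_at.
have [/andP[/eqP den1 e0]|not_nat] := boolP ((denq e == 1) && (0 <= e)); last first.
  case: ifP => // /andP[/eqP den1 ed0].
  case/negP: not_nat; have ed := divq_num_den (e - d%:R).
  have E : e = (numq (e - d%:R) + d%:Z)%:~R.
    by rewrite -[LHS](subrK d%:R) -{1}ed den1 divr1 intrD pmulrn.
  have n0 : 0 <= numq (e - d%:R) by rewrite numq_ge0.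
  by rewrite E denq_int eqxx ler0z; lia.
have [n En] : exists n : nat, e = n%:R.
  exists `|numq e|%N; rewrite -{1}[e]divq_num_den den1 divr1 pmulrn gez0_abs //.
  by rewrite numq_ge0.
rewrite En coefXnM (_ : numq n%:R = n%:Z); last by rewrite pmulrn numq_int.
have [lt_nd|le_dn] := ltnP.
  by rewrite subr_ge0 ler_nat leqNgt lt_nd andbF.
by rewrite -natrB // !pmulrn denq_int numq_int eqxx ler0z.
Qed.

Lemma coef_at_zsum N (c : int -> nat) (F : int -> {poly rat}) e :
  zsum N (fun j => (-1) ^+ c j * coef_at (F j) e)
  = coef_at (zsum N (fun j => (-1) ^+ c j * F j)) e.
Proof.
rewrite /coef_at; case: ifP => _; last by rewrite /zsum big1 // => i _; rewrite mulr0.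
rewrite /zsum coef_sum; apply: eq_bigr => i _.
by rewrite -signr_odd -[in RHS]signr_odd; case: odd; rewrite ?mulN1r ?mul1r ?coefN.
Qed.

Lemma coef_at_ge0 p e : nonneg p -> 0 <= coef_at p e.
Proof. by move=> p_ge0; rewrite /coef_at; case: ifP. Qed.

Lemma nonneg_comp_poly_Xn n p : (0 < n)%N -> nonneg (p \Po 'X^n) -> nonneg p.
Proof.
move=> n_gt0 pn i; have := pn (n * i)%N.
by rewrite coef_comp_poly_Xn // dvdn_mulr // mulKn.
Qed.

Theorem theorem2p5 (L nu s n : nat) :
  (0 < nu)%N -> (s < nu)%N -> (2 <= n)%N ->
  let A : rat := ((2 ^ (2 * n) - 1)%N%:R / 3%:R) * nu%:R
                 + ((2 ^ (2 * n - 1) + 1)%N%:R / 3%:R) in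
  let D : rat := (2 ^ (n - 2))%N%:R * (2 * nu + 1)%N%:R in
  G_nonneg (L%:Z - (2 ^ (n - 1) * s)%N%:Z - (2 ^ (n - 2))%N%:Z)
           (L%:Z + (2 ^ (n - 1) * s)%N%:Z + (2 ^ (n - 2))%N%:Z)
           (A * (nu + s + 1)%N%:R / D)
           (A * (nu - s)%N%:R / D)
           ((2 ^ (n - 1) * (2 * nu + 1))%N%:Z).
Proof.
move=> nu_gt0 lt_s_nu; case: n => [|[|m]] // _ A D e.
rewrite /Gcoef; set N := _ - _ - _; set T := _ + _ + _ + N.
set K' := (_ * _)%N%:Z; set al := A * _ / D; set be := A * _ / D.
have -> : T = L.*2%:Z by rewrite /T /N -addnn PoszD; ring.
set B := (`|N| + _)%N.
pose g (j : int) := absz (j * ((2 * nu%:Z + 1) * j + 2 * s%:Z + 1)).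
pose E (j : int) := (bressoud_slope nu m.+1 * g j)%N.
have Gexp_nat j : Gexp K' al be j = (E j)%:R.
  rewrite /al /be /K' /D (_ : A = (bressoud_slope nu m.+1)%:R).
    rewrite !subSS !subn0 expnS Gexp_bressoud ?expn_gt0 ?(ltnW lt_s_nu) //.
    rewrite /E natrM; congr (_ * _).
    by rewrite -[RHS]/((g j)%:Z%:~R) gez0_abs ?bressoud_exp_ge0.
  exact: bressoud_slope_rat.
pose P : {poly rat} := zsum B (fun j =>
  (-1) ^+ `|j| * ('X^(E j) * gaussZ 'X L.*2 (N - K' * j))).
suff -> : \sum_(i < (B + B).+1) (let j := i%:Z - B%:Z in
    (-1) ^+ `|j| * coef_at (qbinZ L.*2 (N - K' * j)) (e - Gexp K' al be j))
    = coef_at P e.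
  (* Substituting ['X^2] for [q] only spreads the coefficients out, and it reaches the variable of
     [bressoud_sum]. *)
  apply/coef_at_ge0/(@nonneg_comp_poly_Xn 2) => //.
  suff -> : P \Po 'X^2 = bressoud_sum nu s B (bressoud_slope nu m.+1) (2 ^ m.+1) L.*2.
    by apply: bressoud_sum_nonneg => //; rewrite /B; lia.
  rewrite /P /zsum rmorph_sum; apply: eq_bigr => i _ /=.
  move: (_%:Z - _%:Z) => j.
  rewrite !rmorphM /= rmorph_sign rmorphXn /= comp_polyX -exprM; congr (_ * (_ * _)).
  (* With [n = m + 2], the lower index [N - K' * j] is [L - 2^m w_j], so [qherm_double] applies with
     [v = 2^m w_j]. *)
  rewrite (_ : (2 ^ m.+1)%N%:Z * _
    = 2 * ((2 ^ m)%N%:Z * (2 * (2 * nu%:Z + 1) * j + 2 * s%:Z + 1))).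
    rewrite qherm_double -gaussZ_morph /= comp_polyX /N /K'.
    congr gaussZ; rewrite !subSS !subn0.
    by rewrite expnS !PoszM; ring.
  by rewrite expnS PoszM; ring.
rewrite -coef_at_zsum; apply: eq_bigr => i _ /=; move: (_%:Z - _%:Z) => j.
by rewrite Gexp_nat coef_atB qbinZ_gaussZ.
Qed.
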